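(* Let $1\le r\le e\le q$ be integers with $r+e+q=n$, let $P_1=(x_1,\dots,x_r)$, $P_2=(x_{r+1},\dots,x_{r+e})$, $P_3=(x_{r+e+1},\dots,x_{r+e+q})$ be prime ideals of $S=K[x_1,\dots,x_n]$, and let $I=P_1\cap P_2\cap P_3$. Then $$\operatorname{sdepth}(S/I)\ge\min\left\{r+e,\ r+\left\lceil\frac{q}{2}\right\rceil,\ \left\lceil\frac{e}{2}\right\rceil+\left\lceil\frac{q}{2}\right\rceil\right\}.$$
   Context: $K$ is a field and $S=K[x_1,\dots,x_n]$ is the polynomial ring, with its standard $\mathbb{Z}^n$-grading. Let $M$ be a finitely generated $\mathbb{Z}^n$-graded $S$-module. For a homogeneous $u\in M$ and a subset $Z\subset\{x_1,\dots,x_n\}$, $uK[Z]$ denotes the $K$-subspace of $M$ generated by all $uv$, $v$ a monomial in $K[Z]$; if $uK[Z]$ is a free $K[Z]$-module it is called a Stanley space of dimension $|Z|$. A Stanley decomposition of $M$ is a presentation of $M$ as a finite direct sum of $\mathbb{Z}^n$-graded $K$-vector spaces $\mathcal{D}: M=\bigoplus_{i=1}^{s}u_iK[Z_i]$ with each $u_iK[Z_i]$ a Stanley space; $\operatorname{sdepth}\mathcal{D}=\min_i|Z_i|$, and $\operatorname{sdepth} M$ is the maximum of $\operatorname{sdepth}\mathcal{D}$ over all Stanley decompositions $\mathcal{D}$ of $M$. *)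

(* Defs.v *)
From HB Require Import structures.
From mathcomp Require Import all_boot all_order all_algebra.
From mathcomp Require Import ring_quotient.
From mathcomp Require Import mpoly boolp.

Set Implicit Arguments.
Unset Strict Implicit.
Unset Printing Implicit Defensive.

Import GRing.Theory.
Local Open Scope ring_scope.
Local Open Scope quotient_scope.

(* The library makes R / I a ring; here it also becomes an R-module. *)
Section QuotientModule.
Variables (R : comNzRingType) (I : idealr R).

Definition quot_scale (a : R) (x : {ideal_quot I}) : {ideal_quot I} :=
  \pi_{ideal_quot I} a * x.

Lemma quot_scaleA a b x : quot_scale a (quot_scale b x) = quot_scale (a * b) x.
Proof. by rewrite /quot_scale rmorphM mulrA. Qed.

Lemma quot_scale1 : left_id 1 quot_scale.
Proof. by move=> x; rewrite /quot_scale rmorph1 mul1r. Qed.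

Lemma quot_scaleDr : right_distributive quot_scale +%R.
Proof. by move=> a x y; rewrite /quot_scale mulrDr. Qed.

Lemma quot_scaleDl x : {morph quot_scale^~ x : a b / a + b}.
Proof. by move=> a b; rewrite /quot_scale rmorphD mulrDl. Qed.

HB.instance Definition _ := GRing.Zmodule_isLmodule.Build R {ideal_quot I}
  quot_scaleA quot_scale1 quot_scaleDr quot_scaleDl.

End QuotientModule.

Section IdealIntersection.
Variables (R : nzRingType) (I J : idealr R).

Definition ideal_cap : R -> bool := fun p => (p \in I) && (p \in J).

Lemma ideal_cap_closed : idealr_closed ideal_cap.
Proof.
split; first by apply/andP; split; apply: rpred0.
  by rewrite unfold_in /ideal_cap !idealr1.
move=> a u v /andP[uI uJ] /andP[vI vJ].
by apply/andP; split; apply: rpredD => //; apply: idealMr.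
Qed.

HB.instance Definition _ := isIdealr.Build R ideal_cap ideal_cap_closed.

End IdealIntersection.

(* An ideal is monomial iff it is Z^n-graded, iff it contains every term of
   each of its elements. *)
HB.mixin Record isMonomialIdeal (K : fieldType) (n : nat)
    (I : {mpoly K[n]} -> bool) := {
  monomial_ideal_subproof :
    forall p m, p \in (I : pred _) -> p@_m *: 'X_[m] \in (I : pred _)
}.

#[short(type="monomial_ideal")]
HB.structure Definition MonomialIdeal (K : fieldType) (n : nat) :=
  {I of Idealr {mpoly K[n]} I & isMonomialIdeal K n I}.

Section MonomialCap.
Variables (K : fieldType) (n : nat) (I J : monomial_ideal K n).

Lemma ideal_cap_monomial (p : {mpoly K[n]}) m :
  p \in ideal_cap I J -> p@_m *: 'X_[m] \in ideal_cap I J.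
Proof.
by move=> /andP[pI pJ]; apply/andP; split; apply: monomial_ideal_subproof.
Qed.

HB.instance Definition _ :=
  isMonomialIdeal.Build K n (ideal_cap I J) ideal_cap_monomial.

End MonomialCap.

(* The ideal of K[x_1, ..., x_n] generated by the variables indexed by A. *)
Section VariableIdeal.
Variables (K : fieldType) (n : nat) (A : {set 'I_n}).

Definition var_ideal : {mpoly K[n]} -> bool := fun p =>
  `[< exists f : 'I_n -> {mpoly K[n]}, p = \sum_(i in A) f i * 'X_i >].

Lemma var_idealP (p : {mpoly K[n]}) :
  reflect (forall m, m \in msupp p -> exists2 i, i \in A & (0 < m i)%N)
          (p \in var_ideal).
Proof.
rewrite unfold_in; apply: (iffP (asboolP _)) => [[f ->] m|h].
  rewrite mcoeff_msupp raddf_sum /= => nz.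
  have [i iA nzi] : exists2 i, i \in A & (f i * 'X_i)@_m != 0.
    apply: contrapT => h; case/eqP: nz; rewrite big1 // => i iA.
    by apply/eqP/negP => /negP nzi; apply: h; exists i.
  exists i => //; move: nzi; rewrite -mcoeff_msupp.
  by rewrite (perm_mem (msuppMX _ _)) => /mapP[m' _ ->]; rewrite mnmDE mnm1E eqxx.
pose g (m : 'X_{1..n}) : option 'I_n := [pick i in A | (0 < m i)%N].
exists (fun i => \sum_(m <- msupp p | g m == Some i) p@_m *: 'X_[(m - U_(i))%MM]).
rewrite {1}(mpolyE p); under [RHS]eq_bigr do rewrite mulr_suml.
rewrite (exchange_big_dep predT) //= big_seq [RHS]big_seq.
apply: eq_bigr => m /h [i0 i0A mi0].
rewrite /g; case: pickP => [i /andP[iA mi]|/(_ i0)]; last by rewrite i0A mi0.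
rewrite (big_pred1 i) => [|j]; last first.
  rewrite /= (inj_eq Some_inj) eq_sym.
  by case: eqP => [->|]; rewrite ?andbF // andbT.
rewrite -scalerAl -mpolyXD submK //; apply/mnm_lepP => j; rewrite mnm1E.
by case: eqP => // <-.
Qed.

Lemma var_ideal_closed : idealr_closed var_ideal.
Proof.
split.
- by apply/var_idealP => m; rewrite msupp0.
- apply/negP => /var_idealP /(_ 0%MM); rewrite msupp1 inE eqxx => /(_ isT)[i _].
  by rewrite mnm0E.
- move=> a u v; rewrite !unfold_in => /asboolP[f ->] /asboolP[g ->].
  apply/asboolP; exists (fun i => a * f i + g i).
  rewrite mulr_sumr -big_split /=; apply: eq_bigr => i _.
  by rewrite mulrDl mulrA.
Qed.

HB.instance Definition _ :=
  isIdealr.Build {mpoly K[n]} var_ideal var_ideal_closed.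

Lemma var_ideal_monomial (p : {mpoly K[n]}) m :
  p \in var_ideal -> p@_m *: 'X_[m] \in var_ideal.
Proof.
move=> /var_idealP h; apply/var_idealP => m'.
rewrite mcoeff_msupp mcoeffZ mcoeffX.
case: (m =P m') => [<-|_] /=; last by rewrite mulr0 eqxx.
by rewrite mulr1 -mcoeff_msupp; apply: h.
Qed.

HB.instance Definition _ :=
  isMonomialIdeal.Build K n var_ideal var_ideal_monomial.

End VariableIdeal.

Arguments var_ideal K {n} A _.

Definition mnm_degree (n : nat) (m : 'X_{1..n}) : {ffun 'I_n -> int} :=
  [ffun i => (m i)%:Z].

(* A Z^n-grading of an S-module, S = K[x_1, ..., x_n]: K-subspaces M_a with
   x^m M_a included in M_(a + m) and M the direct sum of all the M_a. *)
Record zn_grading (K : fieldType) (n : nat) (M : lmodType {mpoly K[n]}) := {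
  gr_piece :> {ffun 'I_n -> int} -> M -> Prop;
  gr_piece0 : forall a, gr_piece a 0;
  gr_pieceD : forall a u v,
    gr_piece a u -> gr_piece a v -> gr_piece a (u + v);
  gr_pieceZ : forall a (c : K) u, gr_piece a u -> gr_piece a (c%:MP *: u);
  gr_pieceX : forall a m u,
    gr_piece a u -> gr_piece (a + mnm_degree m) ('X_[m] *: u);
  gr_span : forall u, exists (s : seq {ffun 'I_n -> int}) (f : _ -> M),
    (forall a, gr_piece a (f a)) /\ u = \sum_(a <- s) f a;
  gr_indep : forall (s : seq {ffun 'I_n -> int}) (f : _ -> M), uniq s ->
    (forall a, gr_piece a (f a)) -> \sum_(a <- s) f a = 0 ->
    forall a, a \in s -> f a = 0
}.

Definition homogeneous (K : fieldType) (n : nat) (M : lmodType {mpoly K[n]})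
  (G : zn_grading M) (u : M) : Prop := exists a, G a u.

(* The grading of S / I: (S / I)_a is the image of S_a. *)
Section QuotientGrading.
Variables (K : fieldType) (n : nat) (I : monomial_ideal K n).
Local Notation S := {mpoly K[n]}.
Local Notation Q := {ideal_quot I}.

Definition poly_piece (a : {ffun 'I_n -> int}) (p : S) : Prop :=
  forall m, m \in msupp p -> mnm_degree m = a.

Definition quot_piece (a : {ffun 'I_n -> int}) (u : Q) : Prop :=
  exists2 p, poly_piece a p & u = \pi_Q p.

Lemma mnm_degreeD (m m' : 'X_{1..n}) :
  mnm_degree (m + m')%MM = mnm_degree m + mnm_degree m'.
Proof. by apply/ffunP => i; rewrite !ffunE mnmDE PoszD. Qed.

Lemma mnm_degree_inj : injective (@mnm_degree n).
Proof.
move=> m m' /ffunP h; apply/mnmP => i.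
by have := h i; rewrite !ffunE => -[].
Qed.

Lemma quot_piece0 a : quot_piece a 0.
Proof. by exists 0; [move=> m; rewrite msupp0 | rewrite rmorph0]. Qed.

Lemma quot_pieceD a u v :
  quot_piece a u -> quot_piece a v -> quot_piece a (u + v).
Proof.
move=> [p hp ->] [q hq ->]; exists (p + q); last by rewrite rmorphD.
by move=> m /msuppD_le; rewrite mem_cat => /orP[/hp|/hq].
Qed.

Lemma quot_pieceZ a (c : K) u : quot_piece a u -> quot_piece a (c%:MP *: u).
Proof.
move=> [p hp ->]; exists (c%:MP * p); last by rewrite rmorphM.
by move=> m; rewrite mul_mpolyC => /msuppZ_le /hp.
Qed.

Lemma quot_pieceX a m u :
  quot_piece a u -> quot_piece (a + mnm_degree m) ('X_[m] *: u).
Proof.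
move=> [p hp ->]; exists ('X_[m] * p); last by rewrite rmorphM.
move=> m'; rewrite mulrC (perm_mem (msuppMX _ _)) => /mapP[k /hp ka ->].
by rewrite mnm_degreeD ka addrC.
Qed.

Lemma quot_span u : exists (s : seq {ffun 'I_n -> int}) (f : _ -> Q),
  (forall a, quot_piece a (f a)) /\ u = \sum_(a <- s) f a.
Proof.
pose p := repr u.
pose f a := \sum_(m <- msupp p | mnm_degree m == a) p@_m *: 'X_[m].
exists [seq mnm_degree m | m <- msupp p], (fun a => \pi_Q (f a)); split.
  move=> a; exists (f a) => // m.
  rewrite mcoeff_msupp /f raddf_sum /= => nz; apply/eqP; apply: contraNT nz => ne.
  rewrite big1 // => k /eqP ka; rewrite mcoeffZ mcoeffX.
  by case: (k =P m) => [km|_] /=; rewrite ?mulr0 //; case/negP: ne; rewrite -km ka.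
rewrite -[LHS]reprK -/p [in LHS](mpolyE p) rmorph_sum [RHS]big_map /=.
rewrite big_seq [RHS]big_seq; apply: eq_bigr => m mp; congr (\pi_Q _).
rewrite /f big_mkcond (bigD1_seq m) ?msupp_uniq //= eqxx big1 ?addr0 // => k ne.
by rewrite (inj_eq mnm_degree_inj) (negPf ne).
Qed.

Lemma quot_indep (s : seq {ffun 'I_n -> int}) (f : _ -> Q) : uniq s ->
  (forall a, quot_piece a (f a)) -> \sum_(a <- s) f a = 0 ->
  forall a, a \in s -> f a = 0.
Proof.
move=> us hf sum0.
have {hf} /choice[p hp] : forall a, exists q : S, poly_piece a q /\ f a = \pi_Q q.
  by move=> a; have [q ? ?] := hf a; exists q.
have piI q : \pi_Q q = 0 -> q \in (I : pred S).
  move=> q0; rewrite -[q]subr0 Quotient.idealrBE; apply/eqP.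
  by rewrite q0 rmorph0.
have sumI : \sum_(a <- s) p a \in (I : pred S).
  apply: piI; rewrite rmorph_sum /= -[RHS]sum0.
  by apply: eq_bigr => a _; rewrite (hp a).2.
move=> a sa; rewrite (hp a).2 (mpolyE (p a)).
have pI : \sum_(m <- msupp (p a)) (p a)@_m *: 'X_[m] \in (I : pred S).
  rewrite big_seq; apply: rpred_sum => m mpa.
  have -> : (p a)@_m = (\sum_(b <- s) p b)@_m; last exact: monomial_ideal_subproof.
  rewrite raddf_sum (bigD1_seq a) //= big1 ?addr0 // => b ba.
  apply: memN_msupp_eq0; apply: contra ba => /(hp b).1 <-.
  by rewrite ((hp a).1 m mpa).
apply/eqP; move: pI; rewrite -[X in X \in _]subr0 Quotient.idealrBE => /eqP ->.
by rewrite rmorph0.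
Qed.

Definition quot_grading : zn_grading Q :=
  Build_zn_grading quot_piece0 quot_pieceD quot_pieceZ quot_pieceX
    quot_span quot_indep.

End QuotientGrading.

Section StanleyDepth.
Variables (K : fieldType) (n : nat) (M : lmodType {mpoly K[n]}).
Local Notation S := {mpoly K[n]}.
Implicit Types (u w : M) (Z : {set 'I_n}).

Definition mnm_in Z (m : 'X_{1..n}) : bool :=
  [forall i, (i \notin Z) ==> (m i == 0%N)].

(* p belongs to the subring K[Z] of S. *)
Definition poly_in Z (p : S) : bool := all (mnm_in Z) (msupp p).

(* w belongs to uK[Z], the K-span of the u v for v a monomial in K[Z]. *)
Definition stanley_span u Z w : Prop :=
  exists (ms : seq 'X_{1..n}) (c : 'X_{1..n} -> K),
    all (mnm_in Z) ms /\ w = \sum_(m <- ms) (c m)%:MP *: ('X_[m] *: u).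

(* N has a finite K[Z]-basis; a cyclic module, such as uK[Z], is free iff it
   has such a basis. *)
Definition free_over Z (N : M -> Prop) : Prop :=
  exists (k : nat) (b : 'I_k -> M), (forall i, N (b i)) /\
    forall w, N w -> exists! c : {ffun 'I_k -> S},
      (forall i, poly_in Z (c i)) /\ w = \sum_i c i *: b i.

(* For u = 0, uK[Z] = 0 is free of rank 0 and is not of dimension #|Z|. *)
Definition stanley_space (G : zn_grading M) u Z : Prop :=
  [/\ homogeneous G u, u != 0 & free_over Z (stanley_span u Z)].

Record stanley_decomposition (G : zn_grading M) := {
  sd_size : nat;
  sd_gen : 'I_sd_size -> M;
  sd_vars : 'I_sd_size -> {set 'I_n};
  sd_stanley : forall i, stanley_space G (sd_gen i) (sd_vars i);
  sd_direct : forall w, exists! f : {ffun 'I_sd_size -> M},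
    (forall i, stanley_span (sd_gen i) (sd_vars i) (f i)) /\ w = \sum_i f i
}.

(* The default value n only matters for the empty decomposition of M = 0. *)
Definition sdepth_decomposition (G : zn_grading M)
    (D : stanley_decomposition G) : nat :=
  \big[minn/n]_(i < sd_size D) #|sd_vars i|.

(* The depth of a decomposition is at most n, so this is a true maximum
   (0 if there is no Stanley decomposition at all). *)
Definition sdepth (G : zn_grading M) : nat :=
  \max_(d < n.+1 | `[< exists D : stanley_decomposition G,
                         sdepth_decomposition D = d >]) d.

End StanleyDepth.

(* Main.v *)
Require Import Defs.
From HB Require Import structures.
From mathcomp Require Import all_boot all_order all_algebra.
From mathcomp Require Import ring_quotient.
From mathcomp Require Import mpoly boolp zify.

(** Let B1, B2, B3 be the three blocks of variables, of sizes r, e, q.  A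
monomial lies outside I iff its support misses one of the blocks, that is, is
contained in the union of the other two.

If a family P of subsets of the variables is the disjoint union of intervals
[A, B], then the monomials with support in P are the disjoint union of the sets
x^A * (monomials of K[B]); so S / I is the direct sum of the Stanley spaces
x^A K[B], and sdepth (S / I) is at least the minimum of the |B|
(sdepth_ge_of_partition).

It remains to cut the sets that miss a block into intervals with large upper
ends (two_of_three_partitionable).  They fall into three disjoint families:
 - the subsets of B1 and B2, a single interval whose upper end has r + e
   elements;
 - the subsets of B1 and B3 that meet B3: products of the interval of all
   subsets of B1 with intervals of nonempty subsets of B3;
 - the subsets of B2 and B3 that meet both: products of intervals of nonempty
   subsets.
The bound r + e, r + ceil (q / 2), ceil (e / 2) + ceil (q / 2) follows, once the
nonempty subsets of a set W are cut into intervals with upper ends of at least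
ceil (|W| / 2) elements (nonempty_partitionable), which is the theorem of Biro,
Howard, Keller, Trotter and Young on the Stanley depth of the maximal ideal.

For that last point, suppose first that |W| is odd, and arrange W in a cycle
with successor map s.  Let X be a nonempty subset of W.  Going round the cycle
from an element of X, build H: take every element of X, and every element whose
predecessor was not taken.  Then H is the set of the elements at even distance
from the last element of X at or before them; it is the only set such that s j
is in H iff s j is in X or j is not in H.  Since no two consecutive elements
are left out, H has at least half of the elements of W.  Let A be the set of
the elements of X whose predecessor is in H.  Deleting from X elements outside
A, or adding elements of H, does not change the recursion that defines H, so
all the sets in [A, H] have the same H and the same A.  These intervals are
therefore disjoint, and they cover.  They contain only nonempty sets: if A were
empty, membership in H would alternate along the cycle, which is impossible on
an odd cycle.  If |W| is even, remove a point z: the sets containing z form the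
single interval [{z}, W], and the odd case applies to the others. *)

Set Implicit Arguments.
Unset Strict Implicit.
Unset Printing Implicit Defensive.

Import GRing.Theory.

(** * Partitions of families of sets into intervals *)

Section IntervalPartition.
Variable T : finType.
Implicit Types (P Q : {set T} -> bool) (A B W X Y H : {set T}).

(** P is a disjoint union of intervals with upper ends of at least d elements.
The partition is given by the maps that send X to the two ends of the interval
containing it; that these maps are constant on each interval makes the
intervals disjoint. *)
Definition interval_partitionable P d : Prop :=
  exists lo hi : {set T} -> {set T}, forall X, P X ->
    [/\ lo X \subset X, X \subset hi X, d <= #|hi X| &
        forall Y, lo X \subset Y -> Y \subset hi X ->
          [/\ P Y, lo Y = lo X & hi Y = hi X]].

Lemma interval_partitionable_weaken P d d' :
  d' <= d -> interval_partitionable P d -> interval_partitionable P d'.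
Proof.
move=> le_d [lo [hi h]]; exists lo, hi => X /h[? ? le_hi ?].
by split=> //; apply: leq_trans le_hi.
Qed.

Lemma interval_partitionable_ext P P' d : P =1 P' ->
  interval_partitionable P d -> interval_partitionable P' d.
Proof.
move=> eqP [lo [hi h]]; exists lo, hi => X; rewrite -eqP => /h[? ? ? hY].
by split=> // Y lY Yh; rewrite -eqP; apply: hY.
Qed.

Lemma interval_partitionable_interval A B :
  interval_partitionable (fun X => (A \subset X) && (X \subset B)) #|B|.
Proof.
exists (fun=> A), (fun=> B) => X /andP[AX XB].
by split=> // Y -> ->.
Qed.

Lemma interval_partitionable_union P Q d : (forall X, P X -> ~~ Q X) ->
  interval_partitionable P d -> interval_partitionable Q d ->
  interval_partitionable (fun X => P X || Q X) d.
Proof.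
move=> disj [lo [hi hP]] [lo' [hi' hQ]].
exists (fun X => if P X then lo X else lo' X).
exists (fun X => if P X then hi X else hi' X) => X.
case: ifP => [/hP[? ? ? h] _|_ /= /hQ[? ? ? h]]; split=> // Y lY Yh.
  by have [-> -> ->] := h Y lY Yh.
have [QY -> ->] := h Y lY Yh.
by rewrite QY orbT; case: ifP => // /disj; rewrite QY.
Qed.

(** The product of an interval of subsets of W and an interval of subsets of W'
is an interval, and the sizes of the upper ends add up. *)
Lemma interval_partitionable_prod P Q W W' d d' : [disjoint W & W'] ->
  (forall X, P X -> X \subset W) -> (forall X, Q X -> X \subset W') ->
  interval_partitionable P d -> interval_partitionable Q d' ->
  interval_partitionable
    (fun X => [&& X \subset W :|: W', P (X :&: W) & Q (X :&: W')]) (d + d').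
Proof.
move=> disj PW QW [lo [hi hP]] [lo' [hi' hQ]].
have WW0 A B : A \subset W -> B \subset W' ->
    ((A :|: B) :&: W = A) * ((A :|: B) :&: W' = B).
  move=> AW BW'; rewrite !setIUl (setIidPl AW) (setIidPl BW').
  have -> : B :&: W = set0.
    by apply: disjoint_setI0; rewrite disjoint_sym; apply: disjointWr disj.
  have -> : A :&: W' = set0 by apply: disjoint_setI0; apply: disjointWl disj.
  by rewrite setU0 set0U.
exists (fun X => lo (X :&: W) :|: lo' (X :&: W')).
exists (fun X => hi (X :&: W) :|: hi' (X :&: W')) => X /and3P[XW PX QX].
have [lX Xh dX h] := hP _ PX; have [lX' Xh' dX' h'] := hQ _ QX.
have loW : lo (X :&: W) \subset W by apply: subset_trans lX (subsetIr _ _).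
have loW' : lo' (X :&: W') \subset W' by apply: subset_trans lX' (subsetIr _ _).
have hiW : hi (X :&: W) \subset W.
  by apply: PW; have [] := h _ (subset_trans lX Xh) (subxx _).
have hiW' : hi' (X :&: W') \subset W'.
  by apply: QW; have [] := h' _ (subset_trans lX' Xh') (subxx _).
split.
- by rewrite -[in Z in _ \subset Z](setIidPl XW) setIUr setUSS.
- by rewrite -[in Z in Z \subset _](setIidPl XW) setIUr setUSS.
- have hi0 := disjoint_setI0 (disjointW hiW hiW' disj).
  by rewrite cardsU hi0 cards0 subn0 leq_add.
move=> Y lY Yh.
have [] := h (Y :&: W).
- by rewrite -(WW0 _ _ loW loW').1 setSI.
- by rewrite -(WW0 _ _ hiW hiW').1 setSI.
move=> -> -> ->; have [] := h' (Y :&: W').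
- by rewrite -(WW0 _ _ loW loW').2 setSI.
- by rewrite -(WW0 _ _ hiW hiW').2 setSI.
move=> -> -> ->; split=> //; rewrite !andbT.
by apply: subset_trans Yh _; apply: setUSS.
Qed.

(** * Nonempty subsets of an odd cycle *)

Section Cycle.
Variables (s : T -> T) (W : {set T}).
Hypothesis s_inj : injective s.
Hypothesis sW : forall j, (s j \in W) = (j \in W).
Hypothesis s_conn : {in W &, forall x y, fconnect s x y}.

(** The recursion for the upper end H of the interval of X: H contains X, and
off X its membership alternates along the cycle. *)
Definition alternating X H : bool :=
  (H \subset W) && [forall j in W, (s j \in H) == (s j \in X) || (j \notin H)].

Lemma alternatingP X H : reflect
  (H \subset W /\ {in W, forall j, (s j \in H) = (s j \in X) || (j \notin H)})
  (alternating X H).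
Proof.
apply: (iffP andP) => -[HW h]; split=> //.
  by move=> j /(forall_inP h) /eqP.
by apply/forall_inP => j /h ->.
Qed.

Lemma surj_in j : j \in W -> exists2 i, i \in W & j = s i.
Proof.
move=> jW; exists (finv s j); last by rewrite f_finv.
by rewrite -sW f_finv.
Qed.

Lemma alternating_sub X H : alternating X H -> X \subset W -> X \subset H.
Proof.
move=> /alternatingP[_ h] /subsetP XW; apply/subsetP => j jX.
have [i iW ji] := surj_in (XW j jX).
by rewrite ji h // -ji jX.
Qed.

(** The recursion determines H from any starting point where its value is known,
and H contains all of X. *)
Lemma alternating_uniq X H H' : X \subset W -> X != set0 ->
  alternating X H -> alternating X H' -> H = H'.
Proof.
move=> XW /set0Pn[x xX] aH aH'.
have xW := subsetP XW x xX.
have eqH t : (iter t s x \in W) && ((iter t s x \in H) == (iter t s x \in H')).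
  elim: t => [|t /andP[tW /eqP eq_t]] /=.
    by rewrite xW (subsetP (alternating_sub aH XW) x xX)
      (subsetP (alternating_sub aH' XW) x xX).
  move: aH aH' => /alternatingP[_ h] /alternatingP[_ h'].
  by rewrite sW tW h // h' // eq_t eqxx.
have [HW _] := alternatingP _ _ aH; have [HW' _] := alternatingP _ _ aH'.
apply/setP => j; case: (boolP (j \in W)) => jW.
  by have:= eqH (findex s x j); rewrite iter_findex ?s_conn // => /andP[_ /eqP].
by rewrite (negPf (contra (subsetP HW j) jW)) (negPf (contra (subsetP HW' j) jW)).
Qed.

(** Start the recursion at a point x of X and go once round the cycle.  On
returning to x it prescribes membership again, consistently as x is in X. *)
Lemma alternating_exists X : X \subset W -> X != set0 ->
  exists H, alternating X H.
Proof.
move=> XW /set0Pn[x xX]; have xW := subsetP XW x xX.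
pose h := fix h t := if t is t'.+1 then (iter t s x \in X) || ~~ h t' else true.
exists [set j in W | h (findex s x j)]; apply/alternatingP; split.
  by apply/subsetP => j; rewrite inE => /andP[].
move=> j jW; rewrite !inE sW jW /=.
have xj : fconnect s x j by apply: s_conn.
have := findex_max xj; rewrite -[in s j](iter_findex xj).
set t := findex s x j; rewrite leq_eqVlt => /orP[/eqP lt_t|lt_t].
  by rewrite -iterS lt_t iter_order // xX findex0.
by rewrite -iterS findex_iter.
Qed.

Definition cycle_hi X := odflt set0 [pick H | alternating X H].
Definition cycle_lo X := X :&: [set s j | j in cycle_hi X].

Lemma cycle_hiP X H : X \subset W -> X != set0 ->
  alternating X H <-> cycle_hi X = H.
Proof.
move=> XW X0; rewrite /cycle_hi; case: pickP => [H' aH'|none] /=.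
  by split=> [|<- //]; apply: alternating_uniq.
by have [H'] := alternating_exists XW X0; rewrite none.
Qed.

(** The successor of a point outside H is in H, so the complement of H injects
into H. *)
Lemma card_alternating X H : alternating X H -> uphalf #|W| <= #|H|.
Proof.
move=> /alternatingP[HW h].
rewrite leq_uphalf_double -addnn -(cardsID H W) (setIidPr HW) leq_add2l.
rewrite -(card_imset _ s_inj); apply/subset_leq_card/subsetP => _ /imsetP[j + ->].
by rewrite !inE => /andP[jH jW]; rewrite h // jH orbT.
Qed.

(** If this intersection were empty, no point of X would follow a point of H, so
the successor map would exchange H and its complement in W. *)
Lemma cycle_lo_neq0 X H : odd #|W| -> alternating X H ->
  X :&: [set s j | j in H] != set0.
Proof.
move=> oddW /alternatingP[HW h]; apply: contraL oddW => /eqP lo0.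
have {}h j : j \in W -> (s j \in H) = (j \notin H).
  move=> jW; rewrite h //; case: (boolP (j \in H)) => [jH|_]; last by rewrite orbT.
  apply/negbTE; rewrite orbF; apply/negP => sjX.
  by have := in_set0 (s j); rewrite -lo0 inE sjX imset_f.
have eqD : [set s j | j in H] = W :\: H.
  apply/setP => i; rewrite !inE; apply/imsetP/andP => [[j jH ->]|[iH iW]].
    have jW := subsetP HW j jH.
    by rewrite sW jW h // jH.
  have [j jW ij] := surj_in iW; exists j => //.
  by move: iH; rewrite ij h // negbK.
by rewrite -(cardsID H W) (setIidPr HW) -eqD card_imset // addnn odd_double.
Qed.

(** A set Y between the lower end of X and H satisfies the same recursion with
H: a point of X missing from Y follows a point outside H, which already puts it
in H, and a point of Y is in H. *)
Lemma cycle_partitionable : odd #|W| -> interval_partitionable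
  (fun X => (X != set0) && (X \subset W)) (uphalf #|W|).
Proof.
move=> oddW; exists cycle_lo, cycle_hi => X /andP[X0 XW].
have aX : alternating X (cycle_hi X) by apply/(cycle_hiP _ XW X0).
split; first exact: subsetIl.
- exact: alternating_sub aX XW.
- exact: card_alternating aX.
rewrite /cycle_lo; have lo0 := cycle_lo_neq0 oddW aX.
move: aX lo0; set H := cycle_hi X => aX lo0 Y lY YH.
have Y0 : Y != set0 by apply: contraNneq lo0 => Y0; rewrite -subset0 -Y0.
have [HW h] := alternatingP _ _ aX.
have YW : Y \subset W by apply: subset_trans HW.
suff hiY : cycle_hi Y = H.
  rewrite hiY Y0 YW; split=> //; apply/eqP; rewrite eqEsubset; apply/andP; split.
    apply/subsetP => i; rewrite !inE => /andP[iY /imsetP[j jH ij]].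
    have := subsetP YH i iY; rewrite ij h ?(subsetP HW) // jH orbF => ->.
    by rewrite imset_f.
  by rewrite subsetI lY subsetIr.
apply/(cycle_hiP _ YW Y0)/alternatingP; split=> // j jW.
apply/idP/orP => [|[sjY|jH]]; last by rewrite h // jH orbT.
  rewrite h //; case: (boolP (j \in H)) => [jH|_]; last by right.
  rewrite orbF => sjX; left; apply: (subsetP lY).
  by rewrite inE sjX imset_f.
exact: (subsetP YH).
Qed.

End Cycle.

(** In the even case a point z is set aside: the sets containing z form one
interval with upper end W, and the remaining sets live on an odd cycle. *)
Lemma nonempty_partitionable W : interval_partitionable
  (fun X => (X != set0) && (X \subset W)) (uphalf #|W|).
Proof.
have odd_case W' : odd #|W'| -> interval_partitionable
    (fun X => (X != set0) && (X \subset W')) (uphalf #|W'|).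
  move=> oddW; have Uw := enum_uniq (mem W').
  (* Any enumeration of W', closed up, is a cycle on W'. *)
  apply: (@cycle_partitionable (next (enum W'))) => //.
  - exact: can_inj (prev_next Uw).
  - by move=> j; rewrite -!(mem_enum W') mem_next.
  - move=> x y xW yW.
    by rewrite (fconnect_cycle (cycle_next Uw)) mem_enum.
case: (boolP (odd #|W|)) => [|evenW]; first exact: odd_case.
have [->|[z zW]] := set_0Vmem W.
  exists id, id => X /andP[X0]; rewrite subset0 => /eqP XE.
  by rewrite XE eqxx in X0.
have cardW : #|W| = #|W :\ z|.+1 by rewrite (cardsD1 z) zW.
have oddW' : odd #|W :\ z| by move: evenW; rewrite cardW /= negbK.
have [m cardW'] : exists m, #|W :\ z| = m.*2.+1.
  by exists #|W :\ z|./2; rewrite -[LHS]odd_double_half oddW'.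
have := odd_case _ oddW'.
have [-> ->] : uphalf #|W :\ z| = m.+1 /\ uphalf #|W| = m.+1.
  by rewrite cardW cardW' /= uphalf_double doubleK.
move=> oddP.
have starP : interval_partitionable
    (fun X => ([set z] \subset X) && (X \subset W)) m.+1.
  apply: interval_partitionable_weaken (interval_partitionable_interval _ _).
  by rewrite cardW cardW' -addnn ltnS -addnS leq_addr.
apply: interval_partitionable_ext (interval_partitionable_union _ starP oddP).
  move=> X; rewrite sub1set subsetD1; case: (boolP (z \in X)) => [zX|_] /=.
    by rewrite !andbF orbF; suff -> : X != set0; last by apply/set0Pn; exists z.
  by rewrite andbT.
by move=> X; rewrite sub1set subsetD1 => /andP[-> _]; rewrite !andbF.
Qed.

End IntervalPartition.

(** * From interval partitions to Stanley decompositions *)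

Section SquarefreeStanley.
Local Open Scope ring_scope.
Local Open Scope quotient_scope.
Variables (K : fieldType) (n : nat) (I : monomial_ideal K n).
Variable P : {set 'I_n} -> bool.
Local Notation S := {mpoly K[n]}.
Local Notation Q := {ideal_quot I}.
Implicit Types (m : 'X_{1..n}) (p c : S) (A B : {set 'I_n}).

Definition mnm_supp m : {set 'I_n} := [set i | (0 < m i)%N].
Definition set_mnm A : 'X_{1..n} := [multinom nat_of_bool (i \in A) | i < n].

Hypothesis IP : forall m, ('X_[m] \in (I : pred S)) = ~~ P (mnm_supp m).

Lemma pi_eq0 p : (\pi_Q p == 0) = (p \in (I : pred S)).
Proof. by rewrite -[in RHS](subr0 p) Quotient.idealrBE rmorph0. Qed.

Lemma scale_pi (a p : S) : a *: \pi_Q p = \pi_Q (a * p).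
Proof. by rewrite rmorphM. Qed.

Lemma pi_monomial_eq0 m : (\pi_Q 'X_[m] == 0) = ~~ P (mnm_supp m).
Proof. by rewrite pi_eq0 IP. Qed.

(** A monomial ideal contains the terms of its elements, so polynomials whose
monomials all lie outside I are determined by their classes modulo I. *)
Lemma pi_inj0 p : \pi_Q p = 0 ->
  (forall m, m \in msupp p -> P (mnm_supp m)) -> p = 0.
Proof.
move=> /eqP; rewrite pi_eq0 => pI hp; apply/mpolyP => m; rewrite mcoeff0.
apply/eqP/negPn/negP => nz.
have := monomial_ideal_subproof _ m pI.
move=> /(idealMr (p@_m)^-1%:MP); rewrite mul_mpolyC scalerA mulVf // scale1r.
by rewrite IP hp // mcoeff_msupp.
Qed.

Lemma mnm_supp_set A : mnm_supp (set_mnm A) = A.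
Proof. by apply/setP => i; rewrite inE mnmE; case: (i \in A). Qed.

Lemma mnm_suppD m m' : mnm_supp (m + m')%MM = mnm_supp m :|: mnm_supp m'.
Proof. by apply/setP => i; rewrite !inE mnmDE addn_gt0. Qed.

Lemma mnm_in_supp B m : mnm_in B m = (mnm_supp m \subset B).
Proof.
apply/forallP/subsetP => [h i|h i]; last first.
  by apply/implyP; apply: contraNT => mi; apply: h; rewrite inE lt0n.
by rewrite inE lt0n; apply: contraNT => iB; have := h i; rewrite iB.
Qed.

Definition supp_between A B p : Prop := forall m, m \in msupp p ->
  (A \subset mnm_supp m) && (mnm_supp m \subset B).

Lemma supp_between_mulX A B c : A \subset B -> poly_in B c ->
  supp_between A B (c * 'X_[set_mnm A]).
Proof.
move=> AB /allP cB m; rewrite (perm_mem (msuppMX _ _)) => /mapP[k /cB kB ->].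
by rewrite mnm_suppD mnm_supp_set subsetUl subUset AB -mnm_in_supp.
Qed.

Lemma supp_betweenB A B p p' : supp_between A B p -> supp_between A B p' ->
  supp_between A B (p - p').
Proof.
move=> hp hp' m /msuppB_le; rewrite mem_cat => /orP[/hp|/hp'] //.
Qed.

(** A monomial is x^A times a monomial of K[B] iff its support lies between A
and B; this is what turns an interval into a Stanley space. *)
Lemma supp_between_divX A B p : supp_between A B p ->
  exists2 c, poly_in B c & p = c * 'X_[set_mnm A].
Proof.
move=> hp; exists (\sum_(m <- msupp p) p@_m *: 'X_[(m - set_mnm A)%MM]).
  apply/allP => m; rewrite mcoeff_msupp raddf_sum /= mnm_in_supp => nz.
  have /hasP[k kp] : has (fun k => (k - set_mnm A)%MM == m) (msupp p).
    apply: contraNT nz => /hasPn h; rewrite big_seq big1 // => k /h.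
    by rewrite mcoeffZ mcoeffX => /negPf ->; rewrite mulr0.
  move=> /eqP <-; have /andP[_] := hp k kp; apply: subset_trans.
  apply/subsetP => i; rewrite !inE mnmBE => /leq_trans; apply.
  exact: leq_subr.
rewrite mulr_suml {1}(mpolyE p) big_seq [RHS]big_seq.
apply: eq_bigr => m /hp /andP[/subsetP Am _].
rewrite -scalerAl -mpolyXD submK //; apply/mnm_lepP => i; rewrite mnmE.
by case: (boolP (i \in A)) => // /Am; rewrite inE.
Qed.

Lemma stanley_spanP A B w :
  stanley_span (\pi_Q 'X_[set_mnm A]) B w <->
  exists2 c, poly_in B c & w = \pi_Q (c * 'X_[set_mnm A]).
Proof.
have piE (ms : seq 'X_{1..n}) (c : _ -> K) :
    \sum_(m <- ms) (c m)%:MP *: ('X_[m] *: \pi_Q 'X_[set_mnm A]) =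
    \pi_Q ((\sum_(m <- ms) c m *: 'X_[m]) * 'X_[set_mnm A]).
  rewrite mulr_suml rmorph_sum; apply: eq_bigr => m _.
  by rewrite !scale_pi mulrA mul_mpolyC.
split=> [[ms [c [/allP msB ->]]]|[c cB ->]].
  exists (\sum_(m <- ms) c m *: 'X_[m]); last exact: piE.
  apply/allP => m; rewrite mcoeff_msupp raddf_sum /= => nz.
  have /hasP[k /msB kB /eqP <- //] : has (pred1 m) ms.
  apply: contraNT nz => /hasPn h; rewrite big_seq big1 // => k /h /= /negPf km.
  by rewrite mcoeffZ mcoeffX km mulr0.
exists (msupp c), (fun m => c@_m); split; first exact: cB.
by rewrite piE -mpolyE.
Qed.

Lemma stanley_span_between A B w : A \subset B ->
  stanley_span (\pi_Q 'X_[set_mnm A]) B w <->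
  exists2 p, supp_between A B p & w = \pi_Q p.
Proof.
move=> AB; rewrite stanley_spanP; split=> [[c cB ->]|[p + ->]].
  by exists (c * 'X_[set_mnm A]); first exact: supp_between_mulX.
by move=> /supp_between_divX[c cB ->]; exists c.
Qed.

(** Multiples of x^A by elements of K[B] only involve monomials with support in
[A, B], hence outside I, so x^A generates a free K[B]-module of rank one. *)
Lemma interval_stanley_space A B : A \subset B ->
  (forall X : {set _}, A \subset X -> X \subset B -> P X) ->
  stanley_space (quot_grading I) (\pi_Q 'X_[set_mnm A]) B.
Proof.
move=> AB PAB; split.
- exists (mnm_degree (set_mnm A)), 'X_[set_mnm A] => // m.
  by rewrite msuppX inE => /eqP ->.
- by rewrite pi_monomial_eq0 mnm_supp_set PAB.
exists 1%N, (fun=> \pi_Q 'X_[set_mnm A]); split=> [_|w].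
  apply/stanley_spanP; exists 1; last by rewrite mul1r.
  apply/allP => m; rewrite msupp1 inE => /eqP ->.
  by apply/forallP => i; rewrite mnm0E eqxx implybT.
move=> /stanley_spanP[c cB wE]; exists [ffun=> c]; split.
  by split=> [i|]; rewrite ?big_ord1 ffunE // scale_pi.
move=> c' [c'B]; rewrite big_ord1 wE scale_pi => /eqP.
rewrite -subr_eq0 -rmorphB => /eqP /pi_inj0.
have dB := supp_betweenB (supp_between_mulX AB cB)
  (supp_between_mulX AB (c'B ord0)).
move=> /(_ (fun m mp => let: conj a b := andP (dB m mp) in PAB _ a b)) /eqP.
rewrite -mulrBl mulf_eq0 subr_eq0 -[X in _ || X]msupp_eq0 msuppX orbF => /eqP ->.
by apply/ffunP => i; rewrite ffunE (ord1 i).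
Qed.

(** The Stanley spaces are indexed by the lower ends of the intervals.  Since the
support of every monomial outside I lies in exactly one interval, sorting the
terms of a representative by interval gives the components of its class, and
two decompositions agree because terms of different components cannot
cancel. *)
Lemma sdepth_ge_of_partition d : (d <= n)%N -> interval_partitionable P d ->
  (d <= sdepth (quot_grading I))%N.
Proof.
move=> le_dn [lo [hi hP]].
pose F := [set A | P A && (lo A == A)].
pose bot (i : 'I_#|F|) : {set 'I_n} := enum_val i.
have botP i : P (bot i) /\ lo (bot i) = bot i.
  by have := enum_valP i; rewrite inE => /andP[? /eqP].
have bot_hi i : bot i \subset hi (bot i) by have [/hP[]] := botP i.
have botI i (X : {set 'I_n}) : bot i \subset X -> X \subset hi (bot i) ->
    P X /\ lo X = bot i.
  have [Pb lob] := botP i; have [_ _ _ h] := hP _ Pb.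
  by rewrite -{1}lob => bX Xh; have [-> ->] := h X bX Xh.
have botE X : P X -> exists i, bot i = lo X.
  move=> PX; have [loX Xhi _ h] := hP X PX.
  have [PloX loloX _] := h _ (subxx _) (subset_trans loX Xhi).
  have loF : lo X \in F by rewrite inE PloX loloX eqxx.
  by exists (enum_rank_in loF (lo X)); rewrite /bot enum_rankK_in.
have bot_inj : injective bot := enum_val_inj.
have sd_st i :
    stanley_space (quot_grading I) (\pi_Q 'X_[set_mnm (bot i)]) (hi (bot i)).
  by apply: interval_stanley_space => // X bX Xh; have [] := botI i X bX Xh.
have sd_dir w : exists! f : {ffun 'I_#|F| -> Q},
    (forall i, stanley_span (\pi_Q 'X_[set_mnm (bot i)]) (hi (bot i)) (f i))
    /\ w = \sum_i f i.
  pose p := repr w.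
  (* The component of w in the i-th space collects the terms of its
     representative with support in the i-th interval. *)
  pose sel i m := P (mnm_supp m) && (lo (mnm_supp m) == bot i).
  pose g i := \sum_(m <- msupp p | sel i m) p@_m *: 'X_[m].
  have gB i : supp_between (bot i) (hi (bot i)) (g i).
    move=> m; rewrite mcoeff_msupp raddf_sum /= => nz.
    have /hasP[k _ /andP[/andP[Pk /eqP lok] /eqP <-]] :
        has (fun k => sel i k && (k == m)) (msupp p).
      apply: contraNT nz => /hasPn h; rewrite big_seq_cond big1 // => k /andP[/h].
      by rewrite mcoeffZ mcoeffX => /nandP[/negPf ->|/negPf ->]; rewrite ?mulr0.
    have [loX Xhi _ h] := hP _ Pk; rewrite -lok loX.
    by have [_ _ ->] := h _ (subxx _) (subset_trans loX Xhi).
  have wg : w = \sum_i \pi_Q (g i).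
    rewrite -[LHS]reprK -/p [in LHS](mpolyE p) rmorph_sum.
    under [RHS]eq_bigr do rewrite rmorph_sum.
    rewrite (exchange_big_dep predT) //=; apply: eq_bigr => m _.
    case: (boolP (P (mnm_supp m))) => [PX|nPX].
      have [i ib] := botE _ PX.
      by rewrite (big_pred1 i) // => j; rewrite /sel PX -ib (inj_eq bot_inj) eq_sym.
    rewrite big_pred0 => [|i]; last by rewrite /sel (negPf nPX).
    apply/eqP; rewrite -mul_mpolyC pi_eq0; apply: idealMr.
    by rewrite IP.
  exists [ffun i => \pi_Q (g i)]; split; first split=> [i|].
  - by rewrite ffunE; apply/stanley_span_between => //; exists (g i).
  - by rewrite wg; apply: eq_bigr => i _; rewrite ffunE.
  move=> f [fB wE].
  have /choice[q hq] : forall i, exists q : S,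
      supp_between (bot i) (hi (bot i)) q /\ f i = \pi_Q q.
    by move=> i; have [q] := (stanley_span_between _ (bot_hi i)).1 (fB i); exists q.
  (* Lifts of two decompositions differ by polynomials r i with disjoint sets of
     monomials, all outside I. *)
  pose r i := g i - q i.
  have rB i : supp_between (bot i) (hi (bot i)) (r i).
    by apply: supp_betweenB; [apply: gB | have [] := hq i].
  have rP i m : m \in msupp (r i) -> P (mnm_supp m) /\ lo (mnm_supp m) = bot i.
    by move=> /rB /andP[]; apply: botI.
  have sum_r : \sum_i r i = 0.
    apply: pi_inj0 => [|m].
      rewrite rmorph_sum; under eq_bigr do rewrite rmorphB.
      rewrite sumrB; apply/eqP; rewrite subr_eq0; apply/eqP.
      transitivity w; first by rewrite wg.
      by rewrite wE; apply: eq_bigr => i _; have [] := hq i.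
    rewrite mcoeff_msupp raddf_sum /= => nz.
    have /existsP[i /rP[//]] : [exists i, m \in msupp (r i)].
    apply: contraNT nz => /existsPn h; rewrite big1 // => i _.
    by apply/eqP; rewrite mcoeff_eq0.
  have r0 i : r i = 0.
    apply/mpolyP => m; rewrite mcoeff0; apply/eqP/negPn/negP.
    rewrite -mcoeff_msupp => mi; have [_ loi] := rP i m mi.
    have := congr1 (mcoeff m) sum_r; rewrite raddf_sum mcoeff0 (bigD1 i) //= big1.
      by rewrite addr0 => /eqP; rewrite mcoeff_eq0 mi.
    move=> j ji; apply/eqP; rewrite mcoeff_eq0; apply: contra ji => /rP[_].
    by rewrite loi => /bot_inj ->.
  apply/ffunP => i; rewrite ffunE (hq i).2; congr (\pi_Q _).
  by apply/eqP; rewrite -subr_eq0; apply/eqP; apply: r0.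
pose D := Build_stanley_decomposition sd_st sd_dir.
have dD : (d <= sdepth_decomposition D <= n)%N.
  apply/andP; split.
    apply: (big_ind (fun k => (d <= k)%N)) => // [k k'|i _].
      by rewrite leq_min => -> ->.
    by have [Pb lob] := botP i; have [] := hP _ Pb.
  by rewrite /sdepth_decomposition; elim/big_ind: _ => // [k k' kn _|i _];
    [apply: leq_trans (geq_minl _ _) kn | rewrite -[X in (_ <= X)%N]card_ord max_card].
have /andP[dD1 dD2] := dD; apply: leq_trans dD1 _.
apply: (bigmax_sup (Ordinal (dD2 : _ < n.+1)%N)) => //.
by apply/asboolP; exists D.
Qed.

End SquarefreeStanley.

(** * The intersection of three primes *)

Lemma mem_var_ideal_monomial (K : fieldType) n (A : {set 'I_n}) (m : 'X_{1..n}) :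
  ('X_[K, m] \in var_ideal K A) = ~~ (mnm_supp m \subset ~: A).
Proof.
apply/var_idealP/subsetPn => [/(_ m)|[i]].
  rewrite msuppX inE eqxx => /(_ isT)[i iA mi].
  by exists i; rewrite !inE ?negbK.
rewrite !inE negbK => mi iA m'.
by rewrite msuppX inE => /eqP ->; exists i.
Qed.

Lemma mem_ideal_cap (R : nzRingType) (J J' : idealr R) (p : R) :
  (p \in ideal_cap J J') = (p \in (J : pred R)) && (p \in (J' : pred R)).
Proof. by []. Qed.

Lemma card_ord_interval n a b : b <= n ->
  #|[set i : 'I_n | a <= i < b]| = b - a.
Proof.
move=> le_bn; rewrite -[RHS]muln1 -sum_nat_const_nat (big_nat_widenl a 0) //.
rewrite (big_nat_widen _ _ _ _ _ le_bn) big_mkord sum1_card cardsE.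
by apply: eq_card => i.
Qed.

(** The sets contained in two of the three blocks are sorted by whether they
miss B3, then B2, then B1, the first block missed deciding.  A set that
misses B2 or B1 then meets every block tested before, which is what makes the
three families disjoint. *)
Lemma two_of_three_partitionable (T : finType) (B1 B2 B3 : {set T}) d :
  [disjoint B1 & B2] -> [disjoint B1 & B3] -> [disjoint B2 & B3] ->
  d <= #|B1| + #|B2| -> d <= #|B1| + uphalf #|B3| ->
  d <= uphalf #|B2| + uphalf #|B3| ->
  interval_partitionable (fun X : {set T} =>
    [|| X \subset B1 :|: B2, X \subset B1 :|: B3 | X \subset B2 :|: B3]) d.
Proof.
move=> d12 d13 d23 le12 le13 le23.
have part12 : interval_partitionable
    (fun X => (set0 \subset X) && (X \subset B1 :|: B2)) d.
  apply: interval_partitionable_weaken (interval_partitionable_interval _ _).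
  by rewrite cardsU disjoint_setI0 // cards0 subn0.
have part13 := interval_partitionable_weaken le13
  (interval_partitionable_prod d13 (fun X XB => proj2 (andP XB))
    (fun X XB => proj2 (andP XB))
    (interval_partitionable_interval set0 B1) (nonempty_partitionable B3)).
have part23 := interval_partitionable_weaken le23
  (interval_partitionable_prod d23 (fun X XB => proj2 (andP XB))
    (fun X XB => proj2 (andP XB))
    (nonempty_partitionable B2) (nonempty_partitionable B3)).
have missing (X A B : {set T}) : X \subset A :|: B -> X :&: B = set0 -> X \subset A.
  by move=> XAB XB0; rewrite -(setIidPl XAB) setIUr XB0 setU0 subsetIr.
have meets3 (X : {set T}) : ~~ (X \subset B1 :|: B2) ->
    (X \subset B1 :|: B3) || (X \subset B2 :|: B3) -> X :&: B3 != set0.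
  move=> X12 X3; apply: contra X12 => /eqP XB3; case/orP: X3 => /missing XB.
    by apply: subset_trans (XB XB3) (subsetUl _ _).
  by apply: subset_trans (XB XB3) (subsetUr _ _).
apply: interval_partitionable_ext (interval_partitionable_union _ part12
  (interval_partitionable_union _ part13 part23)) => X /=;
  rewrite !sub0set !subsetIr !andbT /=.
- case: (boolP (X \subset B1 :|: B2)) => //= /meets3 X3.
  case: (boolP (X \subset B1 :|: B3)) X3 => [_ /(_ isT) -> //|X13] /=.
  case: (boolP (X \subset B2 :|: B3)) => //= X23 /(_ isT) ->; rewrite andbT.
  apply: contra X13 => /eqP XB2; rewrite setUC in X23.
  by apply: subset_trans (missing _ _ _ X23 XB2) (subsetUr _ _).
- move=> X12; suff -> : X :&: B3 == set0 by rewrite /= !andbF.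
  rewrite -subset0 (subset_trans (setSI _ X12)) // setIUl.
  by rewrite !disjoint_setI0 // setU0.
- move=> /andP[X13 _]; suff -> : X :&: B2 == set0 by rewrite andbF.
  rewrite -subset0 (subset_trans (setSI _ X13)) // setIUl.
  by rewrite !disjoint_setI0 ?setU0 // disjoint_sym.
Qed.

Theorem lemma2p6 (K : fieldType) (n r e q : nat)
    (hr : 1 <= r) (hre : r <= e) (heq : e <= q) (hn : r + e + q = n) :
  let P1 := var_ideal K [set i : 'I_n | i < r] in
  let P2 := var_ideal K [set i : 'I_n | r <= i < r + e] in
  let P3 := var_ideal K [set i : 'I_n | r + e <= i < r + e + q] in
  let I := ideal_cap (ideal_cap P1 P2) P3 in
  is_true (minn (r + e) (minn (r + uphalf q) (uphalf e + uphalf q))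
             <= sdepth (quot_grading I)).
Proof.
move=> P1 P2 P3 I.
pose B1 := [set i : 'I_n | 0 <= i < r].
pose B2 := [set i : 'I_n | r <= i < r + e].
pose B3 := [set i : 'I_n | r + e <= i < r + e + q].
have c1 : #|B1| = r by rewrite card_ord_interval ?subn0 // -hn; lia.
have c2 : #|B2| = e by rewrite card_ord_interval -?hn; lia.
have c3 : #|B3| = q by rewrite card_ord_interval -?hn; lia.
have disj (A B : {set 'I_n}) : (forall i, i \in A -> i \notin B) -> [disjoint A & B].
  by move=> h; rewrite disjoint_subset; apply/subsetP.
have d12 : [disjoint B1 & B2] by apply: disj => i; rewrite !inE; lia.
have d13 : [disjoint B1 & B3] by apply: disj => i; rewrite !inE; lia.
have d23 : [disjoint B2 & B3] by apply: disj => i; rewrite !inE; lia.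
apply: (@sdepth_ge_of_partition _ _ _ (fun X : {set 'I_n} =>
    [|| X \subset B1 :|: B2, X \subset B1 :|: B3 | X \subset B2 :|: B3])).
- move=> m; rewrite !mem_ideal_cap !mem_var_ideal_monomial.
  have -> : ~: [set i : 'I_n | i < r] = B2 :|: B3.
    by apply/setP => i; rewrite !inE; have := ltn_ord i; lia.
  have -> : ~: B2 = B1 :|: B3.
    by apply/setP => i; rewrite !inE; have := ltn_ord i; lia.
  have -> : ~: B3 = B1 :|: B2.
    by apply/setP => i; rewrite !inE; have := ltn_ord i; lia.
  by rewrite -!negb_or orbC orbA orbAC -orbA.
- by rewrite -hn geq_min leq_addr.
by apply: two_of_three_partitionable => //; rewrite ?c1 ?c2 ?c3; lia.
Qed.
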